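(* Let $\phi$ be an essentially smooth transformation whose conjugate $\psi=\phi^\star$ is twice continuously differentiable with $\psi''>0$, and let costs be Csiszár information with transformation $\phi$. Let $(\pi_1,A_1)$ be a decision problem with finite state space $\Theta_1$, and consider the joint decision problems (one for each reward level $w>0$) obtained by adding to it an identification task with state space $\Theta_2=\{1,\dots,n\}$, reward $w$, and fraction $\gamma=m/n$ of correct actions in each state, as described in the context. Then there is a selection $w\mapsto P^w$ of optimal choice rules for the joint decision problem such that for every $\theta=(\theta_1,\theta_2)\in\Theta$, every $a_1\in A_1$, and every sequence of reward levels $(w_k)$ such that $w_k\downarrow0$ and $P_\pi^{w_k}(a_1)>0$ for every $k$, $$\log\frac{P^{w_k}_\theta(\{a_2:a_2(\theta_2)=w_k\}\mid a_1)}{P^{w_k}_\theta(\{a_2:a_2(\theta_2)=0\}\mid a_1)}=\log\frac{\gamma}{1-\gamma}+w_k\,R_\psi\big(a_1(\theta_1)-\lambda_{\pi_1}(\theta_1)\big)+o(w_k),$$ where $R_\psi(t)=\psi''(t)/\psi'(t)$ and $\lambda_{\pi_1}$ is the (prior-adjusted) Lagrange multiplier associated with the decision problem $(\pi_1,A_1)$.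
   Context: A transformation is a convex, lower semicontinuous $\phi:\mathbb{R}_+\to[0,+\infty]$ with $\phi(1)=0$ which (standing assumption) is superlinear at infinity ($\phi(t)/t\to+\infty$ as $t\to+\infty$), strictly convex on $\operatorname{int}(\operatorname{dom}\phi)$, and satisfies $1\in\operatorname{int}(\operatorname{dom}\phi)$. It is essentially smooth if it is finite and differentiable on $(0,+\infty)$ and $\lim_{t\to0}\phi'(t)=-\infty$. Conjugate: $\phi^\star(t)=\sup_{u\ge0}tu-\phi(u)$. A decision problem $(\pi,A)$ on a finite state space $\Theta$ consists of a full-support prior $\pi\in\Delta(\Theta)$ and a finite nonempty set $A$ of actions, each with utilities $a(\theta)$. The Csiszár information of $P\in\Delta(A)^\Theta$ is $I(P,\pi)=\min_{\alpha\in\Delta(A)}\sum_{\theta}\pi(\theta)\sum_{a\in A}\alpha(a)\phi(P_\theta(a)/\alpha(a))$, with $0\cdot\phi(x/0)=\lim_{t\to+\infty}\phi(1+tx)/t$; the same $\phi$ is used on all state spaces. $P$ is optimal if it maximizes $\sum_\theta\pi(\theta)\sum_aP_\theta(a)a(\theta)-I(P,\pi)$ over $\Delta(A)^\Theta$. Lagrange multiplier: $\lambda_\pi\in\mathbb{R}^\Theta$ is the (prior-adjusted) Lagrange multiplier associated with $(\pi,A)$ if for some $\alpha\in\Delta(A)$, $(\alpha,\lambda_\pi)$ is a saddle point (maximum over $\alpha\in\Delta(A)$, minimum over $\lambda_\pi\in\mathbb{R}^\Theta$) of $$\sum_{a\in A}\alpha(a)\sum_{\theta\in\Theta}\pi(\theta)\psi(a(\theta)-\lambda_\pi(\theta))+\sum_{\theta\in\Theta}\pi(\theta)\lambda_\pi(\theta);$$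 when $\phi$ is essentially smooth it is unique. Joint problem: fix integers $1\le m<n$ and $n$ distinct subsets $E_1,\dots,E_n$ of $\Theta_2=\{1,\dots,n\}$, each with $m$ elements, such that each element of $\Theta_2$ belongs to exactly $m$ of them. For reward $w>0$ the identification task has uniform prior on $\Theta_2$ and action set $A_2$ consisting of the $n$ actions $a_2$ with $a_2(\theta_2)=w$ if $\theta_2\in E_j$ and $0$ otherwise, $j=1,\dots,n$. The joint decision problem has state space $\Theta=\Theta_1\times\Theta_2$, prior $\pi(\theta_1,\theta_2)=\frac1n\pi_1(\theta_1)$, action set $A=A_1\times A_2$, and payoffs $a(\theta_1,\theta_2)=a_1(\theta_1)+a_2(\theta_2)$ for $a=(a_1,a_2)$. For a choice rule $P\in\Delta(A)^\Theta$, $P_\pi(a_1)=\sum_\theta\pi(\theta)\sum_{a_2}P_\theta(a_1,a_2)$, and $P_\theta(\cdot\mid a_1)$ is the conditional distribution over $A_2$ given that the first component of the action is $a_1$, under $P_\theta$. *)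

(* Defs.v *)
From HB Require Import structures.
From mathcomp Require Import all_boot all_order all_algebra.
From mathcomp Require Import all_classical all_reals all_analysis.

Set Implicit Arguments.
Unset Strict Implicit.
Unset Printing Implicit Defensive.

Import Order.TTheory GRing.Theory Num.Theory.
Import numFieldNormedType.Exports.

Local Open Scope ring_scope.
Local Open Scope classical_set_scope.

Definition effective_domain (R : realType) (phi : R -> \bar R) : set R :=
  [set t | (phi t < +oo)%E].

(* A function on [0, +oo[ with values in [0, +oo] is encoded by its extension
   to the whole line with the value +oo on ]-oo, 0[; this changes neither
   convexity, nor lower semicontinuity, nor the interior (in the real line) of
   the effective domain. *)
Record transformation (R : realType) (phi : R -> \bar R) : Prop := {
  transf_neg : forall t : R, t < 0 -> phi t = +oo%E ;
  transf_ge0 : forall t : R, (0 <= phi t)%E ;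
  transf_convex : forall (x y t : R), 0 <= t <= 1 ->
    (phi (t * x + (1 - t) * y)%R <= t%:E * phi x + (1 - t)%R%:E * phi y)%E ;
  transf_lsc : lower_semicontinuous phi ;
  transf_1 : phi 1 = 0%E ;
  transf_superlinear : (phi t * (t^-1)%:E)%E @[t --> +oo] --> +oo%E ;
  transf_strict : forall x y t : R,
    (effective_domain phi)° x -> (effective_domain phi)° y -> x != y ->
    0 < t < 1 ->
    (phi (t * x + (1 - t) * y)%R < t%:E * phi x + (1 - t)%R%:E * phi y)%E ;
  transf_int1 : (effective_domain phi)° 1
}.

Record essentially_smooth (R : realType) (phi : R -> \bar R) : Prop := {
  essm_fin : forall t : R, 0 < t -> phi t \is a fin_num ;
  essm_diff : forall t : R, 0 < t -> derivable (fine \o phi) t 1 ;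
  essm_lim : derive1 (fine \o phi) t @[t --> 0^'+] --> -oo
}.

(* Superlinearity makes the supremum finite, so that [fine] loses nothing. *)
Definition conjugate (R : realType) (phi : R -> \bar R) (t : R) : R :=
  fine (ereal_sup [set ((t * u)%R%:E - phi u)%E | u in [set u : R | 0 <= u]]).

Record C2_pos (R : realType) (psi : R -> R) : Prop := {
  C2_derivable : forall t : R, derivable psi t 1 ;
  C2_derivable' : forall t : R, derivable (derive1 psi) t 1 ;
  C2_continuous : continuous (derive1 (derive1 psi)) ;
  C2_gt0 : forall t : R, 0 < derive1 (derive1 psi) t
}.

Definition curvature (R : realType) (psi : R -> R) (t : R) : R :=
  derive1 (derive1 psi) t / derive1 psi t.

Definition simplex (R : realType) (T : finType) : set (T -> R) :=
  [set p | (forall x, 0 <= p x) /\ \sum_x p x = 1].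

Definition choice_rule (R : realType) (S A : finType) : set (S -> A -> R) :=
  [set P | forall s, simplex (P s)].

(* A decision problem is a prior together with a finite type of actions and
   the utility [u a s] of action [a] in state [s]; distinct actions may have the
   same utilities. *)
Definition decision_problem (R : realType) (S A : finType) (p : S -> R)
    (u : A -> S -> R) : Prop :=
  [/\ simplex p, forall s, 0 < p s & (0 < #|A|)%N].

(* [c * phi (x / c)], extended to [c = 0] by the recession limit, which exists in
   [\bar R] by convexity of [phi]. *)
Definition perspective (R : realType) (phi : R -> \bar R) (x c : R) : \bar R :=
  if c == 0 then lim ((phi (1 + t * x)%R * (t^-1)%:E)%E @[t --> +oo])
  else (c%:E * phi (x / c)%R)%E.

(* The infimum is a minimum: the objective is lower semicontinuous in [alpha] on
   the compact simplex. *)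
Definition csiszar_information (R : realType) (phi : R -> \bar R)
    (S A : finType) (P : S -> A -> R) (p : S -> R) : \bar R :=
  ereal_inf [set (\sum_s (p s)%:E * \sum_a perspective phi (P s a) (alpha a))%E
            | alpha in @simplex R A].

Definition net_value (R : realType) (phi : R -> \bar R) (S A : finType)
    (p : S -> R) (u : A -> S -> R) (P : S -> A -> R) : \bar R :=
  ((\sum_s p s * \sum_a P s a * u a s)%R%:E - csiszar_information phi P p)%E.

Definition optimal (R : realType) (phi : R -> \bar R) (S A : finType)
    (p : S -> R) (u : A -> S -> R) (P : S -> A -> R) : Prop :=
  choice_rule P /\
  forall Q, choice_rule Q -> (net_value phi p u Q <= net_value phi p u P)%E.

Definition lagrangian (R : realType) (psi : R -> R) (S A : finType)
    (p : S -> R) (u : A -> S -> R) (alpha : A -> R) (lambda : S -> R) : R :=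
  \sum_a alpha a * (\sum_s p s * psi (u a s - lambda s))
  + \sum_s p s * lambda s.

Definition lagrange_multiplier (R : realType) (psi : R -> R) (S A : finType)
    (p : S -> R) (u : A -> S -> R) (lambda : S -> R) : Prop :=
  exists2 alpha, simplex alpha &
    (forall beta, simplex beta ->
       lagrangian psi p u beta lambda <= lagrangian psi p u alpha lambda) /\
    (forall mu, lagrangian psi p u alpha lambda <= lagrangian psi p u alpha mu).

Definition identification_design (n m : nat) (E : 'I_n -> {set 'I_n}) : Prop :=
  [/\ injective E, forall j, #|E j| = m &
      forall s, #|[pred j | s \in E j]| = m].

(* The actions are indexed by ['I_n], action [j] being the bet that the state
   belongs to [E j]. *)
Definition identification_utility (R : realType) (n : nat)
    (E : 'I_n -> {set 'I_n}) (w : R) (j s : 'I_n) : R :=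
  if s \in E j then w else 0.

Definition joint_prior (R : realType) (n : nat) (S : finType) (p : S -> R)
    (s : S * 'I_n) : R := n%:R^-1 * p s.1.

Definition joint_utility (R : realType) (S1 S2 A1 A2 : finType)
    (u1 : A1 -> S1 -> R) (u2 : A2 -> S2 -> R) (a : A1 * A2) (s : S1 * S2) : R :=
  u1 a.1 s.1 + u2 a.2 s.2.

Definition first_action_prob (R : realType) (S A1 A2 : finType) (p : S -> R)
    (P : S -> A1 * A2 -> R) (a1 : A1) : R :=
  \sum_s p s * \sum_a2 P s (a1, a2).

(* Junk value 0 when the conditioning event has probability 0. *)
Definition cond_prob (R : realType) (S A1 A2 : finType)
    (P : S -> A1 * A2 -> R) (s : S) (B : pred A2) (a1 : A1) : R :=
  (\sum_(a2 | B a2) P s (a1, a2)) / (\sum_a2 P s (a1, a2)).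

(* Main.v *)
(** Write [psi] for the conjugate of [phi].  Fenchel's inequality makes the
    Lagrangian at a saddle point [(alpha, lambda)] an upper bound for the net
    value of every choice rule, and the rule
    [P s a = alpha a * psi' (u a s - lambda s)] attains it, since stationarity
    in [lambda] makes it a probability.  By the symmetry of the identification
    task, the joint problem has a saddle point that ignores the second
    components: [lambda] depends on the first state only, [alpha] is uniform on
    the bets, and the pair is a saddle point for the first problem with [psi]
    replaced by [mixed gamma w psi = gamma psi (. + w) + (1 - gamma) psi].
    The odds of a correct bet given [a1] are then
    [gamma / (1 - gamma) * psi' (t + w) / psi' t] with [t = u1 a1 s - lambda_w s],
    so that the mean value theorem applied to [ln psi'] yields the expansion once
    [lambda_w] is known to converge.  For this, [mixed gamma w psi] lies between
    [psi] and [psi (. + w)], so [lambda_w] minimizes the Lagrangian of the first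
    problem up to [w], and that Lagrangian is strictly convex in [lambda]. *)
Require Import Defs.
From HB Require Import structures.
From mathcomp Require Import all_boot all_order all_algebra.
From mathcomp Require Import all_classical all_reals all_analysis.
From mathcomp Require Import ring lra.
Import Order.TTheory GRing.Theory Num.Theory.
Import numFieldNormedType.Exports.
Local Open Scope ring_scope.
Local Open Scope classical_set_scope.

(** * Mean value theorem and tangent inequality on the real line *)

Section RealDerivatives.
Set Implicit Arguments.
Unset Strict Implicit.
Context (R : realType).
Implicit Types (f : R -> R) (a b x y : R).

Lemma derivable_MVT f : (forall x, derivable f x 1) -> forall a b, a < b ->
  exists2 c, a < c < b & f b - f a = derive1 f c * (b - a).
Proof.
move=> df a b ab.
have [c cab ->] : exists2 c, c \in `]a, b[%R & f b - f a = derive1 f c * (b - a).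
  apply: MVT => //.
    by move=> x _; apply: DeriveDef (df x) _; rewrite derive1E.
  by apply: continuous_subspaceT => x; apply/differentiable_continuous/derivable1_diffP.
by exists c.
Qed.

Lemma derive1_gt0_increasing f : (forall x, derivable f x 1) ->
  (forall x, 0 < derive1 f x) -> {homo f : x y / x < y}.
Proof.
move=> df f0 x y xy; have [c _ e] := derivable_MVT df xy.
by rewrite -subr_gt0 e mulr_gt0 ?subr_gt0.
Qed.

Lemma derivable_all_continuous f : (forall x, derivable f x 1) -> continuous f.
Proof. by move=> df x; apply/differentiable_continuous/derivable1_diffP. Qed.

Lemma increasing_derive1_tangent f : (forall x, derivable f x 1) ->
  {homo derive1 f : x y / x < y} -> forall x y, f x + derive1 f x * (y - x) <= f y.
Proof.
move=> df f' x y; case: (ltgtP x y) => [xy|yx|->]; last lra.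
  have [c /andP[/f' xc cy] e] := derivable_MVT df xy.
  rewrite -lerBrDl e; apply: ler_wpM2r; lra.
have [c /andP[yc /f' cx] e] := derivable_MVT df yx.
suff : derive1 f c * (x - y) <= derive1 f x * (x - y) by lra.
apply: ler_wpM2r; lra.
Qed.

End RealDerivatives.

(** * The conjugate: finiteness, slopes, and the two sides of Fenchel's inequality *)

Section Conjugate.
Set Implicit Arguments.
Unset Strict Implicit.
Context (R : realType) (phi : R -> \bar R).
Hypothesis hphi : transformation phi.
Local Notation psi := (conjugate phi).

(** Superlinearity gives [phi u >= |t| * u] beyond some [N], so the objective is nonpositive there,
    while below [N] it is at most [|t| * N]. The point [u = 1] bounds the supremum from below. *)
Lemma conjugate_fin_num t :
  ereal_sup [set ((t * u)%R%:E - phi u)%E | u in [set u : R | 0 <= u]]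
    \is a fin_num.
Proof.
have [M [_ hM]] := (cvgeyPge _).1 (transf_superlinear hphi) `|t|.
pose N := Num.max M 0 + 1.
have N0 : 0 < N by rewrite ltr_wpDl// le_max lexx orbT.
have MN : M < N by rewrite ltr_pwDr// le_max lexx.
rewrite fin_numE; apply/andP; split.
  rewrite -ltNye; apply: (@lt_le_trans _ _ t%:E); first exact: ltNyr.
  apply: ereal_sup_ubound; exists 1; first exact: ler01.
  by rewrite mulr1 (transf_1 hphi) sube0.
rewrite -ltey; apply: (@le_lt_trans _ _ (`|t| * N)%:E); last exact: ltry.
apply: ge_ereal_sup => _ /= [u u0 <-].
have htu : t * u <= `|t| * u by rewrite ler_wpM2r// ler_norm.
have p0 := transf_ge0 hphi u.
have [uN|Nu] := leP u N.
  apply: (@le_trans _ _ (t * u)%:E); first by rewrite geeDl// oppe_le0.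
  by rewrite lee_fin (le_trans htu)// ler_wpM2l.
have {}u0 : 0 < u by apply: lt_trans Nu.
have := hM u (lt_trans MN Nu); rewrite lee_pdivlMr// => h.
apply: (@le_trans _ _ 0%E); last by rewrite lee_fin mulr_ge0// ltW.
rewrite sube_le0; apply: le_trans h.
by rewrite -EFinM lee_fin.
Qed.

Lemma conjugate_young t u : 0 <= u -> ((t * u)%:E - phi u <= (psi t)%:E)%E.
Proof.
move=> u0; rewrite /conjugate fineK ?conjugate_fin_num//.
by apply: ereal_sup_ubound; exists u.
Qed.

Lemma conjugate_young_fine t u r : 0 <= u -> phi u = r%:E ->
  t * u - r <= psi t.
Proof. by move=> u0 e; have := conjugate_young t u0; rewrite e -EFinB lee_fin. Qed.

(** Stands in for attainment of the supremum in the arguments below. *)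
Lemma conjugate_near_max t e : 0 < e ->
  exists u r, [/\ 0 <= u, phi u = r%:E & psi t - e < t * u - r].
Proof.
move=> e0; have := conjugate_fin_num t => /(ub_ereal_sup_adherent e0)[_ [u u0 <-]].
rewrite -[X in (X - _)%E]fineK ?conjugate_fin_num// -/(conjugate phi t) -EFinB.
have := transf_ge0 hphi u; case E : (phi u) => [r||]//= _ h.
by exists u, r.
Qed.

Hypothesis hpsi : C2_pos psi.
Local Notation dpsi := (derive1 psi).

Lemma conjugate_derive1_increasing : {homo dpsi : x y / x < y}.
Proof.
by apply: derive1_gt0_increasing; [exact: C2_derivable'|exact: C2_gt0].
Qed.

Lemma conjugate_derive1_continuous : continuous dpsi.
Proof. by apply: derivable_all_continuous; exact: C2_derivable'. Qed.

Lemma conjugate_tangent x y : psi x + dpsi x * (y - x) <= psi y.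
Proof.
apply: increasing_derive1_tangent; first exact: C2_derivable.
exact: conjugate_derive1_increasing.
Qed.

(** The supremum runs over [u >= 0] only, and each [t * u - phi u] is then nondecreasing in [t]. *)
Lemma conjugate_nondecreasing : {homo psi : x y / x <= y}.
Proof.
move=> x y xy; apply/ler_addgt0Pr => e e0.
have [u [r [u0 pu h]]] := conjugate_near_max x e0.
have h1 := conjugate_young_fine y u0 pu.
have := ler_wpM2r u0 xy; lra.
Qed.

(** Monotonicity of [psi] only yields a nonnegative slope at [t - 1]; strict growth of [dpsi] makes
    it positive at [t]. *)
Lemma conjugate_derive1_gt0 t : 0 < dpsi t.
Proof.
have h := conjugate_tangent t (t - 1).
have h1 := conjugate_tangent (t - 1) (t - 2).
have h2 : psi (t - 2) <= psi (t - 1) by apply: conjugate_nondecreasing; lra.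
have h3 : dpsi (t - 1) < dpsi t by apply: conjugate_derive1_increasing; lra.
lra.
Qed.

(* Near-maximizers of [t * u - phi u] are approximate subgradients of [psi] at
   [t], hence close to [dpsi t]; lower semicontinuity passes to the limit. *)
Lemma conjugate_fenchel t : (phi (dpsi t) <= (t * dpsi t - psi t)%:E)%E.
Proof.
apply/lee_addgt0Pr => e e0; rewrite -EFinD leNgt; apply/negP => lt.
have [V /nbhs_ballP[d /= d0 dV] hV] := transf_lsc hphi lt.
(* The first bound keeps [u] in the neighbourhood given by semicontinuity; the second makes
   [t * (u - dpsi t)] cost at most [e / 2]. *)
pose d' := Num.min d (e / (2 * (`|t| + 1))).
have t1 : 0 < `|t| + 1 by rewrite ltr_wpDl.
have d'0 : 0 < d' by rewrite lt_min d0/= divr_gt0// mulr_gt0.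
have /cvgrPdist_lt/(_ (d' / 2)) := @conjugate_derive1_continuous t.
rewrite divr_gt0// => /(_ isT)/nbhs_ballP[h0 /= h00 hh].
pose h := h0 / 2.
have hpos : 0 < h by rewrite divr_gt0.
have bp : `|dpsi t - dpsi (t + h)| < d' / 2.
  by apply: hh; rewrite /ball/= opprD addrA subrr add0r normrN gtr0_norm// /h; lra.
have bm : `|dpsi t - dpsi (t - h)| < d' / 2.
  by apply: hh; rewrite /ball/= opprB addrC subrK gtr0_norm// /h; lra.
(* Comparing slopes over a step [h] divides the error by [h], leaving [d' / 2]; the other [e / 2] is
   the remaining budget for the value of [phi]. *)
pose eps := Num.min (h * (d' / 2)) (e / 2).
have eps0 : 0 < eps by rewrite lt_min !mulr_gt0 ?divr_gt0.
have [u [r [u0 pu hu]]] := conjugate_near_max t eps0.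
have eps1 : eps <= h * (d' / 2) by rewrite ge_min lexx.
have eps2 : eps <= e / 2 by rewrite ge_min lexx orbT.
have up : `|dpsi t - u| < d'.
  have a1 := conjugate_young_fine (t + h) u0 pu.
  have a2 := conjugate_young_fine (t - h) u0 pu.
  have b1 := conjugate_tangent (t + h) t.
  have b2 := conjugate_tangent (t - h) t.
  move: bp bm; rewrite !ltr_norml => /andP[p1 p2] /andP[m1 m2].
  apply/andP; split.
    suff : h * (u - dpsi t) < h * d' by rewrite ltr_pM2l//; lra.
    have : h * (dpsi (t + h) - dpsi t) < h * (d' / 2) by rewrite ltr_pM2l//; lra.
    lra.
  suff : h * (dpsi t - u) < h * d' by rewrite ltr_pM2l//; lra.
  have : h * (dpsi t - dpsi (t - h)) < h * (d' / 2) by rewrite ltr_pM2l//; lra.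
  lra.
have : ((t * dpsi t - psi t + e)%:E < phi u)%E.
  by apply/hV/dV; rewrite /ball/= (lt_le_trans up)// ge_min lexx.
rewrite pu lte_fin.
have : t * (u - dpsi t) <= e / 2.
  apply: le_trans (ler_norm _) _; rewrite normrM distrC.
  have : `|t| * `|dpsi t - u| <= `|t| * (e / (2 * (`|t| + 1))).
    by rewrite ler_wpM2l// (le_trans (ltW up))// ge_min lexx orbT.
  move=> /le_trans; apply.
  rewrite mulrA ler_pdivrMr ?mulr_gt0//.
  have := normr_ge0 t; nra.
lra.
Qed.

Hypothesis hsmooth : essentially_smooth phi.

(** If all slopes were at least [1], then [psi t <= psi 0 + t] for [t < 0], against the Young bound
    [psi t >= t / 2 - phi (1 / 2)] for very negative [t]. With the next lemma, this brackets the
    slope [1] needed for stationarity. *)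
Lemma conjugate_derive1_lt1 : exists t, dpsi t < 1.
Proof.
have /fineK/esym e : phi 2^-1 \is a fin_num by apply: (essm_fin hsmooth); rewrite invr_gt0.
set r := fine _ in e.
have h t := @conjugate_young_fine t _ r (ltW _) e.
apply: contrapT => /forallNP hn.
have hn' t : 1 <= dpsi t by rewrite leNgt; apply/negP/hn.
pose t := - 2 * (`|psi 0| + `|r| + 1).
have i0 : 0 < 2^-1 :> R by rewrite invr_gt0.
have := h i0 t; have := conjugate_tangent t 0; have := hn' t.
have := ler_norm (psi 0); have := ler_norm r.
have := normr_ge0 (psi 0); have := normr_ge0 r.
rewrite /t; set a := `|r|; set b := `|psi 0| => *.
have : (2 * (b + a + 1)) * 1 <= (2 * (b + a + 1)) * dpsi (-2 * (b + a + 1)).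
  by rewrite ler_wpM2l//; lra.
lra.
Qed.

(** Slopes at most [1] would give [psi t <= psi 0 + t] for [t > 0], against the Young bound
    [psi t >= 2 * t - phi 2]. *)
Lemma conjugate_derive1_gt1 : exists t, 1 < dpsi t.
Proof.
have /fineK/esym e : phi 2 \is a fin_num by apply: (essm_fin hsmooth).
set r := fine _ in e.
have h t := @conjugate_young_fine t _ r (ltW _) e.
apply: contrapT => /forallNP hn.
have hn' t : dpsi t <= 1 by rewrite leNgt; apply/negP/hn.
pose t := `|psi 0| + `|r| + 1.
have i0 : 0 < 2 :> R by [].
have := h i0 t; have := conjugate_tangent t 0; have := hn' t.
have := ler_norm (psi 0); have := ler_norm r.
have := normr_ge0 (psi 0); have := normr_ge0 r.
rewrite /t; set a := `|r|; set b := `|psi 0| => *.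
have : (b + a + 1) * dpsi (b + a + 1) <= (b + a + 1) * 1.
  by rewrite ler_wpM2l//; lra.
lra.
Qed.

(** Young's inequality at [x / c], scaled by [c]. For [c = 0] the recession limit is [+oo] by
    superlinearity if [x > 0], and [0] if [x = 0]. *)
Lemma perspective_lower_bound x c t : 0 <= x -> 0 <= c ->
  ((x * t - c * psi t)%:E <= perspective phi x c)%E.
Proof.
move=> x0 c0; rewrite /perspective; case: eqVneq => [->|cn0].
  rewrite mul0r subr0; move: x0; rewrite le_eqVlt => /predU1P[<-|x0].
    rewrite mul0r (_ : (fun _ => _) = cst 0%E) ?lim_cst//.
    by apply/funext => s; rewrite mulr0 addr0 (transf_1 hphi) mul0e.
  suff -> : lim ((phi (1 + s * x)%R * (s^-1)%:E)%E @[s --> +oo]) = +oo%E by rewrite leey.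
  apply/cvg_lim => //; apply/cvgeyPge => B.
  (* A growth rate [|B| / x] at the point [1 + s * x] is a rate of at least [|B|] in [s]. *)
  have [M [_ hM]] := (cvgeyPge _).1 (transf_superlinear hphi) (`|B| / x).
  exists (Num.max (M / x) 0); split; first by rewrite num_real.
  move=> s; rewrite gt_max => /andP[Ms s0].
  have y0 : 0 < 1 + s * x by rewrite ltr_wpDl// mulr_gt0.
  have := hM (1 + s * x); rewrite lee_pdivlMr// => /(_ _) h.
  rewrite lee_pdivlMr//; apply: le_trans (h _); last first.
    by move: Ms; rewrite ltr_pdivrMr//; lra.
  rewrite -!EFinM lee_fin.
  apply: (@le_trans _ _ (`|B| * s)); first by rewrite ler_wpM2r ?ler_norm// ltW.
  rewrite mulrAC ler_pdivlMr// -mulrA ler_wpM2l//; lra.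
have {c0}c0 : 0 < c by rewrite lt0r cn0.
have xc : 0 <= x / c by rewrite divr_ge0// ltW.
have := conjugate_young t xc; have := transf_ge0 hphi (x / c).
case: (phi (x / c)) => [r||]//=; last by rewrite gt0_muley ?leey.
rewrite -EFinB -EFinM !lee_fin => _ h.
have : c * (t * (x / c) - r) <= c * psi t by rewrite ler_wpM2l// ltW.
by rewrite mulrBr (_ : c * (t * (x / c)) = x * t); [lra|field].
Qed.

(** The equality case of the preceding bound: the ratio [x / c] is the slope [dpsi t]. *)
Lemma perspective_derive1_upper_bound c t : 0 <= c ->
  (perspective phi (c * dpsi t) c <= (c * dpsi t * t - c * psi t)%:E)%E.
Proof.
rewrite /perspective; case: eqVneq => [-> _|cn0 c0].
  rewrite !mul0r subr0 (_ : (fun _ => _) = cst 0%E) ?lim_cst//.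
  by apply/funext => s; rewrite mulr0 addr0 (transf_1 hphi) mul0e.
rewrite mulrAC divff// mul1r.
have := lee_wpmul2l (_ : (0 <= c%:E)%E) (conjugate_fenchel t).
by rewrite lee_fin => /(_ c0)/le_trans; apply; rewrite -EFinM lee_fin; lra.
Qed.

End Conjugate.

(** * Saddle points of the Lagrangian: existence and stability *)

Section SaddlePoint.
Set Implicit Arguments.
Unset Strict Implicit.
Import ArrowAsProduct.
Context (R : realType).

Lemma cvg_fin_sum (I : finType) T (F : set_system T) {FF : Filter F}
    (h : I -> T -> R) (l : I -> R) :
  (forall i, h i x @[x --> F] --> l i) ->
  \sum_i h i x @[x --> F] --> \sum_i l i.
Proof.
move=> hl; have addc : continuous (fun z : R * R => z.1 + z.2).
  exact: add_continuous.
by apply: (@cvg_big _ _ _ 0 xpredT addc _ F (index_enum I) h l) => i _; exact: hl.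
Qed.

(** In the product topology on [A -> R], a closed subset of the cube, which is compact by
    Tychonoff. *)
Lemma simplex_compact (A : finType) : compact (@simplex R A).
Proof.
apply: (@subclosed_compact _ _
  [set p : A -> R | forall a, `[0, 1] (p a)]); last first.
- move=> p [p0 p1] a /=; rewrite in_itv/= p0/= -p1 (bigD1 a)//= lerDl.
  by apply: sumr_ge0.
- exact: (@tychonoff A (fun=> R) (fun=> `[0, 1]) (fun=> @segment_compact R 0 1)).
have -> : @simplex R A = \bigcap_a [set p | 0 <= p a] `&`
    (fun p : A -> R => \sum_a p a) @^-1` [set 1].
  by apply/seteqP; split => p [p0 p1]; split => // a; [move=> _|]; exact: p0.
apply: closedI.
  apply: closed_bigI => a _.
  by apply: (@closed_comp _ _ (fun p : A -> R => p a) [set x | 0 <= x]);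
    [move=> p _; exact: (@proj_continuous A (fun=> R) a)|exact: closed_ge].
apply: closed_comp; last exact: closed_eq.
move=> p _; apply: (@cvg_fin_sum A _ (nbhs p) _ (fun a p => p a)) => a.
exact: (@proj_continuous A (fun=> R) a).
Qed.

Context (S A : finType) (p : S -> R) (u : A -> S -> R) (f : R -> R).
Local Notation g := (derive1 f).
Local Notation L := (lagrangian f p u).
Implicit Types (alpha beta : A -> R) (lambda : S -> R) (s : S) (l : R).

(** The derivative in [l] of [state_lagrangian alpha s] is [1 - total_slope alpha s l], so the value
    [1] is the first-order condition; it also says that the weights [alpha a * g (u a s - l)] sum to
    one. *)
Definition total_slope alpha s l : R := \sum_a alpha a * g (u a s - l).

Definition stationary alpha lambda := forall s, total_slope alpha s (lambda s) = 1.

(** On the simplex the root exists and is unique, so the default [0] is returned only for other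
    [alpha]. *)
Definition stationary_multiplier alpha s : R :=
  xget 0 [set l | total_slope alpha s l = 1].
Local Notation mult := stationary_multiplier.

Definition state_lagrangian alpha s l : R :=
  \sum_a alpha a * f (u a s - l) + l.

Lemma lagrangianE alpha lambda :
  L alpha lambda = \sum_s p s * state_lagrangian alpha s (lambda s).
Proof.
rewrite /lagrangian; under eq_bigr do rewrite mulr_sumr.
rewrite exchange_big/= -big_split/=; apply: eq_bigr => s _.
rewrite mulrDr mulr_sumr; congr (_ + _); apply: eq_bigr => a _.
by rewrite mulrCA.
Qed.

Hypothesis p0 : forall s, 0 <= p s.
Hypothesis df : forall x, derivable f x 1.
Hypothesis gc : continuous g.
Hypothesis ginc : {homo g : x y / x < y}.

Lemma state_lagrangian_tangent alpha s x y : simplex alpha ->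
  state_lagrangian alpha s x + (1 - total_slope alpha s x) * (y - x)
  <= state_lagrangian alpha s y.
Proof.
move=> [al0 _]; rewrite /state_lagrangian /total_slope.
suff : \sum_a alpha a * f (u a s - x) +
    (\sum_a alpha a * g (u a s - x)) * (x - y) <=
    \sum_a alpha a * f (u a s - y) by lra.
rewrite mulr_suml -big_split/=.
apply: ler_sum => a _; rewrite -mulrA -mulrDr ler_wpM2l//.
have := increasing_derive1_tangent df ginc (u a s - x) (u a s - y).
by rewrite (_ : u a s - y - (u a s - x) = x - y)//; lra.
Qed.

Lemma stationary_min alpha lambda : simplex alpha -> stationary alpha lambda ->
  forall mu, L alpha lambda <= L alpha mu.
Proof.
move=> hal st mu; rewrite !lagrangianE; apply: ler_sum => s _.
apply: ler_wpM2l => //.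
by have := state_lagrangian_tangent s (lambda s) (mu s) hal; rewrite st; lra.
Qed.

(** Every term is weakly decreasing; equality of the sums would force every weight [alpha a] to
    vanish, but the weights sum to [1]. *)
Lemma total_slope_decreasing alpha s : simplex alpha ->
  {homo total_slope alpha s : x y / x < y >-> y < x}.
Proof.
move=> [al0 al1] x y xy; rewrite /total_slope.
have gxy a : g (u a s - y) < g (u a s - x) by apply: ginc; lra.
have le : \sum_a alpha a * g (u a s - y) <= \sum_a alpha a * g (u a s - x).
  by apply: ler_sum => a _; rewrite ler_wpM2l// ltW.
rewrite lt_neqAle le andbT; apply/eqP => /esym/eqP.
rewrite -subr_eq0 -sumrB psumr_eq0; last first.
  by move=> a _; rewrite -mulrBr mulr_ge0// subr_ge0 ltW.
move=> /allP h; suff : \sum_a alpha a = 0 by rewrite al1 => /eqP; rewrite oner_eq0.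
apply: big1 => a _; have := h a; rewrite mem_index_enum => /(_ isT).
rewrite -mulrBr mulf_eq0 => /orP[/eqP//|].
by rewrite subr_eq0 gt_eqF.
Qed.

Lemma state_lagrangian_gap alpha s l e : simplex alpha ->
  total_slope alpha s l = 1 -> 0 < e ->
  exists2 d, 0 < d & forall y, e <= `|y - l| ->
    state_lagrangian alpha s l + d <= state_lagrangian alpha s y.
Proof.
move=> hal hl e0.
have tg := state_lagrangian_tangent s _ _ hal.
(* By convexity it suffices to look halfway: the tangents at [l + e / 2] and [l - e / 2] have slopes
   [c1] and [- c2], and gain at least a slope times [e / 2] by distance [e]. *)
pose c1 := 1 - total_slope alpha s (l + e / 2).
pose c2 := total_slope alpha s (l - e / 2) - 1.
have c10 : 0 < c1.
  by rewrite subr_gt0 -[ltRHS]hl total_slope_decreasing//; lra.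
have c20 : 0 < c2.
  by rewrite subr_gt0 -[ltLHS]hl total_slope_decreasing//; lra.
have c2E : 1 - total_slope alpha s (l - e / 2) = - c2 by rewrite opprB.
exists (Num.min c1 c2 * (e / 2)).
  by rewrite mulr_gt0 ?lt_min ?c10 ?divr_gt0.
have m1 : Num.min c1 c2 * (e / 2) <= c1 * (e / 2).
  by rewrite ler_wpM2r ?ge_min ?lexx// ltW// divr_gt0.
have m2 : Num.min c1 c2 * (e / 2) <= c2 * (e / 2).
  by rewrite ler_wpM2r ?ge_min ?lexx ?orbT// ltW// divr_gt0.
move=> y; rewrite ler_normr => /orP[ly|yl].
  have := tg (l + e / 2) y; have := tg l (l + e / 2); rewrite hl -/c1.
  have : c1 * (e / 2) <= c1 * (y - (l + e / 2)) by rewrite ler_wpM2l//; lra.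
  lra.
have := tg (l - e / 2) y; have := tg l (l - e / 2); rewrite hl c2E.
have : c2 * (e / 2) <= c2 * (l - e / 2 - y) by rewrite ler_wpM2l//; lra.
lra.
Qed.

Lemma total_slope_cvg T (F : set_system T) {FF : Filter F} (al : T -> A -> R)
    alpha (la : T -> S -> R) lambda s :
  (forall a, al x a @[x --> F] --> alpha a) ->
  (la x s @[x --> F] --> lambda s) ->
  total_slope (al x) s (la x s) @[x --> F] --> total_slope alpha s (lambda s).
Proof.
move=> hal hla; apply: cvg_fin_sum => a.
apply: cvgM => //; apply: continuous_cvg; first exact: gc.
by apply: cvgB => //; exact: cvg_cst.
Qed.

Lemma lagrangian_cvg T (F : set_system T) {FF : Filter F} (al : T -> A -> R)
    alpha (la : T -> S -> R) lambda :
  (forall a, al x a @[x --> F] --> alpha a) ->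
  (forall s, la x s @[x --> F] --> lambda s) ->
  L (al x) (la x) @[x --> F] --> L alpha lambda.
Proof.
move=> hal hla; have fc := derivable_all_continuous df.
apply: cvgD; last first.
  by apply: cvg_fin_sum => s; apply: cvgM; [exact: cvg_cst|exact: hla].
apply: cvg_fin_sum => a; apply: cvgM; first exact: hal.
apply: cvg_fin_sum => s; apply: cvgM; first exact: cvg_cst.
apply: continuous_cvg; first exact: fc.
by apply: cvgB => //; exact: cvg_cst.
Qed.

Hypothesis glo : exists t, g t < 1.
Hypothesis ghi : exists t, 1 < g t.

(** Intermediate value theorem: the total slope is an average of values of [g], all below [1] for
    large [l] and all above [1] for very negative [l], uniformly over the finitely many actions. *)
Lemma stationary_multiplierP alpha : simplex alpha ->
  stationary alpha (mult alpha).
Proof.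
move=> hal s; have [al0 al1] := hal; rewrite /mult.
case: xgetP => // hn; exfalso.
have [tl hl] := glo; have [th hh] := ghi.
pose B := \sum_a `|u a s|.
have uB a : `|u a s| <= B by rewrite /B (bigD1 a)//= lerDl sumr_ge0.
have gw := ltW_homo ginc.
have h1 : total_slope alpha s (B - tl) <= 1.
  rewrite -al1; apply: ler_sum => a _; rewrite -[leRHS]mulr1 ler_wpM2l//.
  apply: le_trans (ltW hl); apply: gw.
  have := uB a; have := ler_norm (u a s); lra.
have h2 : 1 <= total_slope alpha s (- B - th).
  rewrite -al1; apply: ler_sum => a _; rewrite -[leLHS]mulr1 ler_wpM2l//.
  apply: le_trans (ltW hh) _; apply: gw.
  by have := uB a; rewrite ler_norml => /andP[]; lra.
have le : - B - th <= B - tl.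
  have : 0 <= B by apply: sumr_ge0.
  have : tl <= th; last by lra.
  rewrite leNgt; apply/negP => /ginc; lra.
have cs : {within `[- B - th, B - tl], continuous (total_slope alpha s)}.
  apply: continuous_subspaceT => l.
  apply: (@total_slope_cvg _ _ _ (fun=> alpha) alpha (fun l _ => l) (fun=> l)).
    by move=> a; exact: cvg_cst.
  exact: cvg_id.
have [|l _ hl1] := @IVT _ _ _ _ 1 le cs.
  by rewrite ge_min le_max h1 h2 orbT.
exact: (hn l).
Qed.

(** The Lagrangian separates over states. Moving away from the stationary value at [s] costs a gap
    weighted by [p s > 0], and no other state can make up for it. *)
Lemma lagrangian_min_well_posed alpha lambda s e : simplex alpha ->
  (forall mu, L alpha lambda <= L alpha mu) -> 0 < p s -> 0 < e ->
  exists2 d, 0 < d &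
    forall mu, L alpha mu < L alpha lambda + d -> `|mu s - lambda s| < e.
Proof.
move=> hal hmin ps e0; have st := stationary_multiplierP hal.
have Lmin := stationary_min hal st.
have gap e' : 0 < e' -> exists2 d, 0 < d & forall mu : S -> R,
    e' <= `|mu s - mult alpha s| -> L alpha (mult alpha) + d <= L alpha mu.
  move=> e'0; have [d d0 hd] := state_lagrangian_gap hal (st s) e'0.
  exists (p s * d); first exact: mulr_gt0.
  move=> mu /hd h; rewrite !lagrangianE (bigD1 s)//= [leRHS](bigD1 s)//=.
  rewrite addrAC -mulrDr lerD ?ler_wpM2l//; apply: ler_sum => r _.
  apply: ler_wpM2l => //.
  by have := state_lagrangian_tangent r (mult alpha r) (mu r) hal; rewrite st; lra.
(* Otherwise the gap at the distance between the two values contradicts minimality of [lambda]. *)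
have -> : lambda s = mult alpha s.
  apply/eqP; apply: contraT => ne.
  have [|d d0] := gap `|lambda s - mult alpha s|.
    by rewrite normr_gt0 subr_eq0.
  by move=> /(_ lambda (lexx _)); have := hmin (mult alpha); lra.
have [d d0 hd] := gap e e0; exists d => // mu h.
rewrite ltNge; apply/negP => /hd.
by have := hmin (mult alpha); have := Lmin lambda; lra.
Qed.

(** The total slopes at [m - e] and [m + e] lie strictly on either side of [1]; this persists along
    the filter, and monotonicity traps the root in between. *)
Lemma stationary_multiplier_cvg T (F : set_system T) {FF : Filter F}
    (al : T -> A -> R) alpha s :
  (forall a, al x a @[x --> F] --> alpha a) ->
  (\forall x \near F, simplex (al x)) -> simplex alpha ->
  mult (al x) s @[x --> F] --> mult alpha s.
Proof.
move=> hal hsim hal0; apply/cvgrPdist_lt => e e0.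
have hm := stationary_multiplierP hal0 s.
set m := mult alpha s in hm *.
have cv l := @total_slope_cvg _ _ FF al alpha (fun _ _ => l) (fun=> l) s hal
  (cvg_cst l).
have lo : total_slope alpha s (m + e) < 1.
  by rewrite -hm; apply: total_slope_decreasing => //; lra.
have hi : 1 < total_slope alpha s (m - e).
  by rewrite -hm; apply: total_slope_decreasing => //; lra.
near=> x.
have xs : simplex (al x) by near: x.
have xlo : total_slope (al x) s (m + e) < 1.
  by near: x; apply: cvgr_lt lo; exact: cv.
have xhi : 1 < total_slope (al x) s (m - e).
  by near: x; apply: cvgr_gt hi; exact: cv.
have xm := stationary_multiplierP xs s.
have anti y z : total_slope (al x) s y < total_slope (al x) s z -> z < y.
  move=> h; rewrite ltNge le_eqVlt; apply/negP => /predU1P[yz|].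
    by rewrite yz ltxx in h.
  by move=> /(total_slope_decreasing s xs); rewrite ltNge (ltW h).
rewrite ltr_norml; apply/andP; split.
  have : mult (al x) s < m + e by apply: anti; rewrite xm.
  lra.
have : m - e < mult (al x) s by apply: anti; rewrite xm.
lra.
Unshelve. all: by end_near. Qed.

(* A maximizer [alpha] of [V := fun alpha => min_mu L alpha mu] over the simplex
   is the first component of a saddle point: along the segment from [alpha] to
   [beta], [V] is at least the affine interpolation between [V alpha] and
   [L beta mu_t], where [mu_t] is the stationary multiplier, so [L beta mu_t] is
   at most [V alpha]; then let [t] tend to [0]. *)
Lemma saddle_point_exists : (0 < #|A|)%N ->
  exists alpha lambda, [/\ simplex alpha, stationary alpha lambda &
    forall beta, simplex beta -> L beta lambda <= L alpha lambda].
Proof.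
move=> /card_gt0P[a0 _].
have sne : @simplex R A !=set0.
  exists (fun a => (a == a0)%:R); split => [a|]; first by rewrite ler0n.
  by rewrite (bigD1 a0)//= eqxx big1 ?addr0// => a /negbTE ->.
(* Continuity of the value function, so that it attains its maximum on the compact simplex. *)
have Vc : {within @simplex R A, continuous (fun al => L al (mult al))}.
  apply/subspace_continuousP => al hal.
  have hal' a : al' a @[al' --> within (@simplex R A) (nbhs al)] --> al a.
    by apply: cvg_within_filter; exact: (@proj_continuous A (fun=> R) a).
  apply: (@lagrangian_cvg _ _ _ id al (fun al' => mult al') (mult al) hal') => s; apply: stationary_multiplier_cvg => //.
  exact: withinT.
have [alpha] := compact_EVT_max sne (@simplex_compact A) Vc.
rewrite inE => hal hmax; exists alpha, (mult alpha); split => //.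
  exact: stationary_multiplierP.
move=> beta hbe.
pose al (t : R) a := (1 - t) * alpha a + t * beta a.
have sal t : 0 < t < 1 -> simplex (al t).
  move=> /andP[t0 t1]; have [al0 al1] := hal; have [be0 be1] := hbe.
  split=> [a|]; first by rewrite addr_ge0// mulr_ge0// ?subr_ge0 ltW.
  by rewrite big_split/= -!mulr_sumr al1 be1; ring.
have near01 : \forall t \near 0^'+, 0 < t < (1 : R).
  near=> t; apply/andP; split; near: t; first exact: nbhs_right_gt.
  exact: nbhs_right_lt.
have alc a : al t a @[t --> 0^'+] --> alpha a.
  apply: cvg_at_right_filter.
  rewrite (_ : alpha a = al 0 a); last by rewrite /al; ring.
  apply: cvgD; apply: cvgM; try exact: cvg_cst; try exact: cvg_id.
  by apply: cvgB; [exact: cvg_cst|exact: cvg_id].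
have mc s : mult (al t) s @[t --> 0^'+] --> mult alpha s.
  by apply: stationary_multiplier_cvg => //; apply: filterS near01 => t /sal.
have Lc : L beta (mult (al t)) @[t --> 0^'+] --> L beta (mult alpha).
  by apply: lagrangian_cvg => // a; exact: cvg_cst.
apply: (ler_cvg_to Lc (cvg_cst (L alpha (mult alpha)))).
apply: filterS near01 => t t01; have /andP[t0 t1] := t01.
have st := sal _ t01.
have h1 : L (al t) (mult (al t)) <= L alpha (mult alpha).
  by apply: hmax; rewrite inE.
have h2 := stationary_min hal (stationary_multiplierP hal) (mult (al t)).
(* For a fixed multiplier the Lagrangian is affine in [alpha] along the segment. *)
have h3 : L (al t) (mult (al t)) =
    (1 - t) * L alpha (mult (al t)) + t * L beta (mult (al t)).
  rewrite /lagrangian [in LHS](eq_bigr (fun a =>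
      (1 - t) * (alpha a * (\sum_s p s * f (u a s - mult (al t) s)))
      + t * (beta a * (\sum_s p s * f (u a s - mult (al t) s))))); last first.
    by move=> a _; rewrite /al; ring.
  by rewrite big_split/= -!mulr_sumr; ring.
have h4 : (1 - t) * L alpha (mult alpha) <= (1 - t) * L alpha (mult (al t)).
  by rewrite ler_wpM2l//; lra.
rewrite -(ler_pM2l t0); lra.
Unshelve. all: by end_near. Qed.

End SaddlePoint.

(** * From saddle points to optimal choice rules *)

Section Verification.
Set Implicit Arguments.
Unset Strict Implicit.
Context (R : realType) (phi : R -> \bar R).
Local Notation psi := (conjugate phi).
Local Notation dpsi := (derive1 psi).
Hypotheses (hphi : transformation phi) (hpsi : C2_pos psi).
Context (S A : finType) (p : S -> R) (u : A -> S -> R).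
Hypothesis p0 : forall s, 0 <= p s.

(** The summands on the left are the Young bounds for the perspective terms. Since each [Q s] has
    mass one, the [lambda] terms collect into the linear part of the Lagrangian. *)
Lemma lagrangian_dual_value (Q : S -> A -> R) beta lambda :
  choice_rule Q ->
  \sum_s p s * \sum_a (Q s a * (u a s - lambda s)
                       - beta a * psi (u a s - lambda s))
  = \sum_s p s * (\sum_a Q s a * u a s) - lagrangian psi p u beta lambda.
Proof.
move=> hQ; rewrite lagrangianE -sumrB; apply: eq_bigr => s _.
rewrite -mulrBr; congr (_ * _); rewrite /state_lagrangian.
rewrite sumrB opprD addrA addrAC; congr (_ - _).
under eq_bigr do rewrite mulrBr.
by rewrite sumrB -mulr_suml (hQ s).2 mul1r.
Qed.

Lemma saddle_point_optimal alpha lambda : simplex alpha ->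
  stationary u psi alpha lambda ->
  (forall beta, simplex beta ->
     lagrangian psi p u beta lambda <= lagrangian psi p u alpha lambda) ->
  optimal phi p u (fun s a => alpha a * dpsi (u a s - lambda s)).
Proof.
move=> hal st hmax; pose P s a := alpha a * dpsi (u a s - lambda s).
have hP : choice_rule P.
  move=> s; split; last exact: st.
  by move=> a; rewrite mulr_ge0 ?hal.1// ltW// conjugate_derive1_gt0.
split=> // Q hQ; set V := lagrangian psi p u alpha lambda.
have upper : (net_value phi p u Q <= V%:E)%E.
  pose X := \sum_s p s * \sum_a Q s a * u a s.
  (* Turns the claim into the lower bound [X - V] on the information, proved for every reference
     distribution [beta]. *)
  rewrite /net_value -/X (_ : V = X - (X - V)); last lra.
  rewrite EFinB leeB// /csiszar_information.
  apply: le_ereal_inf_tmp => _ [beta hbe <-].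
  apply: (@le_trans _ _ (X - lagrangian psi p u beta lambda)%:E).
    by rewrite lee_fin lerB// hmax.
  rewrite -(lagrangian_dual_value _ _ hQ) -sumEFin; apply: lee_sum => s _.
  rewrite EFinM; apply: lee_wpmul2l; first by rewrite lee_fin.
  rewrite -sumEFin; apply: lee_sum => a _.
  by apply: perspective_lower_bound; [exact: hphi|exact: (hQ s).1|exact: hbe.1].
have lower : (V%:E <= net_value phi p u P)%E; last exact: le_trans upper lower.
pose X := \sum_s p s * \sum_a P s a * u a s.
rewrite /net_value -/X (_ : V = X - (X - V)); last lra.
rewrite EFinB leeB// /csiszar_information.
(* The saddle distribution [alpha] itself serves as the reference distribution for [P]. *)
apply: ge_ereal_inf; eexists; first by exists alpha; [exact: hal|reflexivity].
rewrite -(lagrangian_dual_value _ _ hP) -sumEFin; apply: lee_sum => s _.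
rewrite EFinM; apply: lee_wpmul2l; first by rewrite lee_fin.
rewrite -sumEFin; apply: lee_sum => a _.
by apply: perspective_derive1_upper_bound; [exact: hphi|exact: hpsi|exact: hal.1].
Qed.

End Verification.

(** * Counting in the identification task *)

Section IdentificationTask.
Set Implicit Arguments.
Unset Strict Implicit.
Context (R : realType) (n m : nat) (E : 'I_n -> {set 'I_n}).
Hypotheses (hm : (1 <= m < n)%N) (hE : identification_design m E).
Local Notation gamma := (m%:R / n%:R : R).
Local Notation idu := (identification_utility E).
Implicit Types (F : R -> R) (w : R).

Let n0 : n%:R != 0 :> R.
Proof. by rewrite pnatr_eq0 -lt0n; case/andP: hm => _; exact: leq_trans. Qed.

Lemma fraction_gt0 : 0 < gamma.
Proof.
case/andP: hm => m1 mn; rewrite divr_gt0// ltr0n//.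
exact: leq_trans mn.
Qed.

Lemma fraction_lt1 : gamma < 1.
Proof.
case/andP: hm => m1 mn; rewrite ltr_pdivrMr ?mul1r ?ltr_nat//.
by rewrite ltr0n; exact: leq_trans mn.
Qed.

Lemma sum_ord_if (B : pred 'I_n) (x y : R) : #|B| = m ->
  \sum_i n%:R^-1 * (if B i then x else y) = gamma * x + (1 - gamma) * y.
Proof.
move=> cB; rewrite -mulr_sumr (bigID B)/=.
rewrite (eq_bigr (fun=> x)) => [|i ->//].
rewrite [X in _ + X](eq_bigr (fun=> y)) => [|i /negbTE ->//].
rewrite !sumr_const cB (_ : #|[pred i | ~~ B i]| = (n - m)%N); last first.
  have := cardC B; rewrite card_ord cB => /(congr1 (subn^~ m)).
  by rewrite addKn.
rewrite -[x *+ m]mulr_natr -[y *+ _]mulr_natr natrB; last by case/andP: hm => _ /ltnW.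
by field.
Qed.

Lemma identification_utilityE F w j s :
  F (idu w j s) = if s \in E j then F w else F 0.
Proof. by rewrite /identification_utility; case: ifP. Qed.

(** Each state lies in [m] of the [n] sets, so a uniformly drawn bet is correct with frequency
    [gamma]; used for stationarity. *)
Lemma average_over_actions F w s :
  \sum_j n%:R^-1 * F (idu w j s) = gamma * F w + (1 - gamma) * F 0.
Proof.
under eq_bigr do rewrite identification_utilityE.
by have [_ _ cE] := hE; exact: (@sum_ord_if [pred j | s \in E j] _ _ (cE s)).
Qed.

(** Dually, each set has [m] elements, so every bet is correct in a fraction [gamma] of the states;
    used for the Lagrangian. *)
Lemma average_over_states F w j :
  \sum_s n%:R^-1 * F (idu w j s) = gamma * F w + (1 - gamma) * F 0.
Proof.
under eq_bigr do rewrite identification_utilityE.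
by have [_ cE _] := hE; exact: (@sum_ord_if [in E j] _ _ (cE j)).
Qed.

Lemma sum_correct_actions F w s : 0 < w ->
  \sum_(j | idu w j s == w) F (idu w j s) = m%:R * F w.
Proof.
move=> w0; rewrite (eq_bigl [pred j | s \in E j]); last first.
  move=> j; rewrite /= /identification_utility; case: ifP => _.
    by rewrite eqxx.
  by rewrite lt_eqF.
rewrite (eq_bigr (fun=> F w)) => [|j /= sj]; last first.
  by rewrite identification_utilityE sj.
by have [_ _ cE] := hE; rewrite sumr_const cE mulr_natl.
Qed.

(** As [w] differs from [0], the wrong bets are the complement of the correct ones, and their number
    follows by subtraction. *)
Lemma sum_wrong_actions F w s : 0 < w ->
  \sum_(j | idu w j s == 0) F (idu w j s) = (n%:R - m%:R) * F 0.
Proof.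
move=> w0; rewrite (eq_bigl (predC (fun j => idu w j s == w))); last first.
  move=> j; rewrite /= /identification_utility; case: ifP => _.
    by rewrite eqxx gt_eqF.
  by rewrite eqxx lt_eqF.
rewrite (eq_bigr (fun=> F 0)) => [|j]; last first.
  rewrite /= identification_utilityE /identification_utility.
  by case: ifP => //; rewrite eqxx.
have := sum_correct_actions (fun=> F 0) s w0.
have : \sum_(j : 'I_n) F 0 = n%:R * F 0 by rewrite sumr_const card_ord mulr_natl.
by rewrite (bigID (fun j => idu w j s == w))/= mulrBl => <- ->; rewrite addrAC subrr add0r.
Qed.

End IdentificationTask.

(** * The averaged conjugate and its comparison with the original one *)

Section Mixed.
Set Implicit Arguments.
Unset Strict Implicit.
Context (R : realType) (c : R) (w : R).
Hypotheses (c01 : 0 < c < 1) (w0 : 0 < w).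

(* The conjugate seen by the first task alone, once the identification task is
   averaged out. *)
Definition mixed (psi : R -> R) (t : R) : R := c * psi (t + w) + (1 - c) * psi t.

Lemma mixed_le (h : R -> R) (y t : R) : h (t + w) <= y -> h t <= y ->
  mixed h t <= y.
Proof.
move: c01 => /andP[c0 c1] hx hy; rewrite /mixed.
have : c * h (t + w) <= c * y by rewrite ler_wpM2l// ltW.
have : (1 - c) * h t <= (1 - c) * y by rewrite ler_wpM2l// subr_ge0 ltW.
lra.
Qed.

Lemma mixed_ge (h : R -> R) (x t : R) : x <= h (t + w) -> x <= h t ->
  x <= mixed h t.
Proof.
move: c01 => /andP[c0 c1] hx hy; rewrite /mixed.
have : c * x <= c * h (t + w) by rewrite ler_wpM2l// ltW.
have : (1 - c) * x <= (1 - c) * h t by rewrite ler_wpM2l// subr_ge0 ltW.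
lra.
Qed.

Variable psi : R -> R.
Hypothesis dpsi : forall t, derivable psi t 1.

Lemma is_derive_mixed (t : R) :
  is_derive t 1 (mixed psi) (mixed (derive1 psi) t).
Proof.
have d (x : R) : is_derive x 1 psi (derive1 psi x).
  by apply: DeriveDef; [exact: dpsi|rewrite derive1E].
have dw : is_derive t 1 (fun t => psi (t + w)) (derive1 psi (t + w)).
  have := @is_derive1_comp _ psi (fun t => t + w) t _ 1 (d _) _.
  rewrite mulr1; apply.
  by rewrite -[X in is_derive _ _ _ X]addr0; apply: is_deriveD.
exact: is_deriveD.
Qed.

Lemma derivable_mixed t : derivable (mixed psi) t 1.
Proof. by have [] := is_derive_mixed t. Qed.

Lemma derive1_mixed : derive1 (mixed psi) = mixed (derive1 psi).
Proof.
by apply/funext => t; rewrite derive1E; have [_ ->] := is_derive_mixed t.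
Qed.

Lemma derive1_mixed_continuous : continuous (derive1 psi) ->
  continuous (derive1 (mixed psi)).
Proof.
rewrite derive1_mixed => pc t; rewrite /mixed.
apply: cvgD; (apply: cvgM; first exact: cvg_cst); last exact: pc.
apply: (@continuous_cvg _ _ _ _ _ (fun t => t + w)); first exact: pc.
by apply: cvgD; [exact: cvg_id|exact: cvg_cst].
Qed.

Lemma derive1_mixed_increasing : {homo derive1 psi : x y / x < y} ->
  {homo derive1 (mixed psi) : x y / x < y}.
Proof.
move: c01 => /andP[c0 c1] pinc x y xy; rewrite derive1_mixed /mixed.
apply: ltrD; rewrite ltr_pM2l ?subr_gt0//; apply: pinc => //.
by rewrite ltrD2r.
Qed.

Lemma derive1_mixed_lt1 : {homo derive1 psi : x y / x < y} ->
  (exists t, derive1 psi t < 1) -> exists t, derive1 (mixed psi) t < 1.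
Proof.
move=> /ltW_homo pinc [t ht]; exists (t - w); rewrite derive1_mixed.
apply: le_lt_trans ht; apply: mixed_le; rewrite ?subrK//.
by apply: pinc; rewrite gerBl ltW.
Qed.

Lemma derive1_mixed_gt1 : {homo derive1 psi : x y / x < y} ->
  (exists t, 1 < derive1 psi t) -> exists t, 1 < derive1 (mixed psi) t.
Proof.
move=> /ltW_homo pinc [t ht]; exists t; rewrite derive1_mixed.
apply: lt_le_trans ht _; apply: mixed_ge => //.
by apply: pinc; rewrite lerDl ltW.
Qed.

Context (S A : finType) (p : S -> R) (u : A -> S -> R).
Hypotheses (hp : simplex p) (pinc : {homo psi : x y / x <= y}).
Implicit Types (alpha : A -> R) (lambda : S -> R).

Lemma lagrangian_le_mixed alpha lambda : simplex alpha ->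
  lagrangian psi p u alpha lambda <= lagrangian (mixed psi) p u alpha lambda.
Proof.
move=> hal; rewrite /lagrangian lerD2r; apply: ler_sum => a _.
rewrite ler_wpM2l ?hal.1//; apply: ler_sum => s _; rewrite ler_wpM2l ?hp.1//.
by apply: mixed_ge => //; apply: pinc; rewrite lerDl ltW.
Qed.

(** Raising the multiplier by [w] absorbs the reward, since [mixed c w psi (t - w) <= psi t]; the
    linear term pays [w] because the prior has mass one. *)
Lemma lagrangian_mixed_shift_le alpha lambda : simplex alpha ->
  lagrangian (mixed psi) p u alpha (fun s => lambda s + w)
  <= lagrangian psi p u alpha lambda + w.
Proof.
move=> hal; rewrite /lagrangian -addrA lerD//.
  apply: ler_sum => a _; rewrite ler_wpM2l ?hal.1//; apply: ler_sum => s _.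
  rewrite ler_wpM2l ?hp.1//; apply: mixed_le; apply: pinc => /=.
    by rewrite opprD addrA subrK.
  by rewrite lerD2l lerN2 lerDl ltW.
under eq_bigr do rewrite mulrDr.
by rewrite big_split/= -mulr_suml hp.2 mul1r.
Qed.

(** Writing [L] and [M] for the original and mixed Lagrangians: [L alpha0 lambda <= M alpha0 lambda
    <= M alpha lambda <= M alpha (lambda0 + w) <= L alpha lambda0 + w <= L alpha0 lambda0 + w]. *)
Lemma mixed_saddle_point_near alpha0 lambda0 alpha lambda :
  simplex alpha0 ->
  (forall beta, simplex beta ->
     lagrangian psi p u beta lambda0 <= lagrangian psi p u alpha0 lambda0) ->
  simplex alpha ->
  (forall beta, simplex beta -> lagrangian (mixed psi) p u beta lambda
     <= lagrangian (mixed psi) p u alpha lambda) ->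
  (forall mu, lagrangian (mixed psi) p u alpha lambda
     <= lagrangian (mixed psi) p u alpha mu) ->
  lagrangian psi p u alpha0 lambda <= lagrangian psi p u alpha0 lambda0 + w.
Proof.
move=> h0 max0 h max min.
apply: le_trans (lagrangian_le_mixed _ h0) _.
apply: le_trans (max _ h0) _.
apply: le_trans (min (fun s => lambda0 s + w)) _.
by apply: le_trans (lagrangian_mixed_shift_le _ h) _; rewrite lerD2r max0.
Qed.

End Mixed.

(** * Reduction of the joint problem to the first one *)

Section JointProblem.
Set Implicit Arguments.
Unset Strict Implicit.
Context (R : realType) (n m : nat) (E : 'I_n -> {set 'I_n}).
Hypotheses (hm : (1 <= m < n)%N) (hE : identification_design m E).
Context (S1 A1 : finType) (p1 : S1 -> R) (u1 : A1 -> S1 -> R).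
Context (psi : R -> R) (w : R).
Hypothesis dpsi : forall t, derivable psi t 1.
Local Notation mpsi := (mixed (m%:R / n%:R) w psi).
Local Notation ju := (joint_utility u1 (identification_utility E w)).

Definition joint_marginal (alpha : A1 -> R) (a : A1 * 'I_n) : R :=
  n%:R^-1 * alpha a.1.

Lemma joint_marginal_simplex alpha : simplex alpha -> simplex (joint_marginal alpha).
Proof.
move=> [al0 al1]; split=> [a|]; first by rewrite mulr_ge0// invr_ge0.
rewrite -(pair_bigA _ (fun a j => n%:R^-1 * alpha a))/=.
under eq_bigr do rewrite sumr_const card_ord -mulrnAl.
rewrite -mulr_sumr al1 mulr1 -mulr_natr mulVf// pnatr_eq0 -lt0n.
by case/andP: hm => _; exact: leq_trans.
Qed.

(** In a fixed state, averaging the derivative of [psi] over the uniform bets gives the derivative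
    of the mixed conjugate. *)
Lemma joint_stationary alpha lambda : stationary u1 mpsi alpha lambda ->
  stationary ju psi (joint_marginal alpha) (fun s => lambda s.1).
Proof.
move=> st s; rewrite -(st s.1) /total_slope derive1_mixed//.
rewrite -(pair_bigA _ (fun a j => joint_marginal alpha (a, j) *
  derive1 psi (ju (a, j) s - lambda s.1)))/=.
apply: eq_bigr => a _; set t := u1 a s.1 - lambda s.1.
have := average_over_actions hm hE (fun x => derive1 psi (t + x)) w s.2.
rewrite addr0 -/(mixed _ _ _ t) => <-; rewrite mulr_sumr; apply: eq_bigr => j _.
rewrite /joint_marginal /joint_utility/= mulrCA mulrA.
by congr (_ * derive1 psi _); rewrite addrAC.
Qed.

(** When the multiplier ignores the second state, averaging over that state gives the same value for
    every bet, so even a correlated [beta] enters only through its first marginal. *)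
Lemma joint_lagrangian beta lambda :
  lagrangian psi (joint_prior p1) ju beta (fun s => lambda s.1)
  = lagrangian mpsi p1 u1 (fun a => \sum_j beta (a, j)) lambda.
Proof.
rewrite /lagrangian; congr (_ + _); last first.
  rewrite -(pair_bigA _ (fun s j => joint_prior p1 (s, j) * lambda s))/=.
  apply: eq_bigr => s _; rewrite /joint_prior/= sumr_const card_ord.
  rewrite -mulrA -mulrnAl -mulr_natr mulVf ?mul1r// pnatr_eq0 -lt0n.
  by case/andP: hm => _; exact: leq_trans.
under [RHS]eq_bigr do rewrite mulr_suml.
rewrite (pair_bigA _ (fun a j => beta (a, j) *
  (\sum_s p1 s * mpsi (u1 a s - lambda s))))/=.
apply: eq_bigr => -[a j] _ /=; congr (_ * _).
rewrite -(pair_bigA _ (fun s k => joint_prior p1 (s, k) *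
  psi (ju (a, j) (s, k) - lambda s)))/=.
apply: eq_bigr => s _; set t := u1 a s - lambda s.
have := average_over_states hm hE (fun x => psi (t + x)) w j.
rewrite addr0 -/(mixed _ _ _ t) => <-; rewrite mulr_sumr; apply: eq_bigr => k _.
rewrite /joint_prior /joint_utility/= [RHS]mulrCA mulrA.
by congr (_ * psi _); rewrite addrAC.
Qed.

Lemma joint_saddle_max alpha lambda : simplex alpha ->
  (forall beta, simplex beta ->
     lagrangian mpsi p1 u1 beta lambda <= lagrangian mpsi p1 u1 alpha lambda) ->
  forall beta, simplex beta ->
    lagrangian psi (joint_prior p1) ju beta (fun s => lambda s.1)
    <= lagrangian psi (joint_prior p1) ju (joint_marginal alpha)
         (fun s => lambda s.1).
Proof.
move=> hal hmax beta [be0 be1]; rewrite !joint_lagrangian.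
have -> : (fun a => \sum_j joint_marginal alpha (a, j)) = alpha.
  apply/funext => a; rewrite /joint_marginal/= sumr_const card_ord.
  rewrite -mulrnAl -mulr_natr mulVf ?mul1r// pnatr_eq0 -lt0n.
  by case/andP: hm => _; exact: leq_trans.
apply: hmax; split=> [a|]; first exact: sumr_ge0.
by rewrite (pair_bigA _ (fun a j => beta (a, j)))/= -be1; apply: eq_bigr => -[].
Qed.

End JointProblem.

(** * First-order expansion of the log-derivative *)

Section Asymptotics.
Set Implicit Arguments.
Unset Strict Implicit.
Context (R : realType) (psi : R -> R).
Hypotheses (hpsi : C2_pos psi) (dpsi0 : forall t, 0 < derive1 psi t).

Lemma curvature_continuous : continuous (curvature psi).
Proof.
move=> t; apply: cvgM; first exact: C2_continuous.
apply: cvgV; first by rewrite gt_eqF.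
exact: derivable_all_continuous (C2_derivable' hpsi) t.
Qed.

Lemma ln_derive1_MVT (a b : R) : a < b -> exists2 x, a < x < b &
  ln (derive1 psi b) - ln (derive1 psi a) = curvature psi x * (b - a).
Proof.
move=> ab.
have d (x : R) : is_derive x 1 (fun x => ln (derive1 psi x)) (curvature psi x).
  have dd : is_derive x 1 (derive1 psi) (derive1 (derive1 psi) x).
    by apply: DeriveDef; [exact: C2_derivable'|rewrite derive1E].
  rewrite /curvature mulrC.
  exact: (@is_derive1_comp _ (@ln R) _ _ _ _ (is_derive1_ln (dpsi0 x)) dd).
have [x|x xab e] := @derivable_MVT _ (fun x => ln (derive1 psi x)) _ _ _ ab.
  by have [] := d x.
by exists x => //; rewrite e derive1E; have [_ ->] := d x.
Qed.

Lemma ln_derive1_expansion (t w : nat -> R) (t0 : R) :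
  t k @[k --> \oo] --> t0 -> (forall k, 0 < w k) -> w k @[k --> \oo] --> 0 ->
  (fun k => ln (derive1 psi (t k + w k)) - ln (derive1 psi (t k))
    - w k * curvature psi t0) =o_\oo w.
Proof.
move=> tc w0 wc; apply/eqoP => e e0.
have /cvgrPdist_le/(_ e e0)/nbhs_ballP[d /= d0 hd] := @curvature_continuous t0.
near=> k.
have tk : `|t0 - t k| < d / 2.
  by near: k; move/cvgrPdist_lt: tc; apply; rewrite divr_gt0.
have wk : `|0 - w k| < d / 2.
  by near: k; move/cvgrPdist_lt: wc; apply; rewrite divr_gt0.
have [|x /andP[x1 x2] ->] := @ln_derive1_MVT (t k) (t k + w k).
  by rewrite ltrDl.
(* The error is [w k] times the change of curvature between [t0] and the intermediate point [x],
   which lies within [d] of [t0]. *)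
rewrite [t k + w k]addrC addrK mulrC -mulrBr normrM mulrC ler_wpM2r//.
rewrite distrC; apply: hd; rewrite /ball/=.
have := w0 k => wk0; move: wk tk.
rewrite sub0r normrN gtr0_norm// !ltr_norml => wk /andP[t1 t2].
by apply/andP; split; lra.
Unshelve. all: by end_near. Qed.

End Asymptotics.

(** * Selection of optimal rules and expansion of the odds *)

Theorem proposition9 (R : realType) (phi : R -> \bar R)
    (hphi : transformation phi) (hsmooth : essentially_smooth phi)
    (hpsi : C2_pos (conjugate phi))
    (S1 A1 : finType) (p1 : S1 -> R) (u1 : A1 -> S1 -> R)
    (hdp : decision_problem p1 u1)
    (lambda : S1 -> R)
    (hlambda : lagrange_multiplier (conjugate phi) p1 u1 lambda)
    (n m : nat) (hm : (1 <= m < n)%N)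
    (E : 'I_n -> {set 'I_n}) (hE : identification_design m E) :
  let gamma : R := m%:R / n%:R in
  exists P : R -> S1 * 'I_n -> A1 * 'I_n -> R,
    (forall w : R, 0 < w ->
       optimal phi (joint_prior p1)
         (joint_utility u1 (identification_utility E w)) (P w)) /\
    forall (s : S1 * 'I_n) (a1 : A1) (w : nat -> R),
      (forall k, 0 < w k) -> w k @[k --> \oo] --> 0 ->
      (forall k, 0 < first_action_prob (joint_prior p1) (P (w k)) a1) ->
      let right k := cond_prob (P (w k)) s
        [pred a2 | identification_utility E (w k) a2 s.2 == w k] a1 in
      let wrong k := cond_prob (P (w k)) s
        [pred a2 | identification_utility E (w k) a2 s.2 == 0] a1 in
      (forall k, [/\ 0 < \sum_a2 P (w k) s (a1, a2), 0 < right k & 0 < wrong k])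
      /\
      (fun k => ln (right k / wrong k)
        - (ln (gamma / (1 - gamma))
           + w k * curvature (conjugate phi) (u1 a1 s.1 - lambda s.1)))
      =o_\oo w.
Proof.
move=> gamma; set psi := conjugate phi in hpsi hlambda *.
have [hp ppos cardA] := hdp.
have p0 s : 0 <= p1 s by rewrite ltW.
have [m1 mn] := andP hm; have n0 : (0 < n)%N by exact: leq_trans mn.
have g01 : 0 < gamma < 1 by rewrite fraction_gt0//= fraction_lt1.
have dpsi := C2_derivable hpsi.
have dc := conjugate_derive1_continuous hpsi.
have dinc := conjugate_derive1_increasing hpsi.
have dlt1 := conjugate_derive1_lt1 hphi hpsi hsmooth.
have dgt1 := conjugate_derive1_gt1 hphi hpsi hsmooth.
have dpos := conjugate_derive1_gt0 hphi hpsi.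
have ninc := conjugate_nondecreasing hphi.
(* The condition [0 < w] sits under the existential so that one saddle point can be chosen for every
   real [w], arbitrary for [w <= 0]. *)
have ex w : exists q : (A1 -> R) * (S1 -> R), 0 < w -> [/\ simplex q.1,
    stationary u1 (mixed gamma w psi) q.1 q.2 &
    forall beta, simplex beta -> lagrangian (mixed gamma w psi) p1 u1 beta q.2
      <= lagrangian (mixed gamma w psi) p1 u1 q.1 q.2].
  have [w0|_] := ltP 0 w; last by exists (fun=> 0, fun=> 0).
  have [||||al [la h]] := @saddle_point_exists R S1 A1 p1 u1
    (mixed gamma w psi) p0 (derivable_mixed dpsi) _ _ _ _ cardA.
  - exact: (derive1_mixed_continuous dpsi dc).
  - exact: (derive1_mixed_increasing w g01 dpsi dinc).
  - exact: (derive1_mixed_lt1 g01 w0 dpsi dinc dlt1).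
  - exact: (derive1_mixed_gt1 g01 w0 dpsi dinc dgt1).
  - by exists (al, la).
have [q hq] := choice ex.
pose t w a s := u1 a s - (q w).2 s.
pose P w s a := joint_marginal (q w).1 a * derive1 psi
  (joint_utility u1 (identification_utility E w) a s - (q w).2 s.1).
exists P; split=> [w w0|s a1 w w0 wc wpos right wrong].
  have [sal st mx] := hq w w0.
  have jp0 r : 0 <= joint_prior (n := n) p1 r.
    by rewrite /joint_prior mulr_ge0// invr_ge0.
  exact: (saddle_point_optimal hphi hpsi jp0 (joint_marginal_simplex hm sal)
    (joint_stationary hm hE dpsi st) (joint_saddle_max hm hE sal mx)).
pose c k := n%:R^-1 * (q (w k)).1 a1.
have PE k r j : P (w k) r (a1, j) = c k * derive1 psi
    (t (w k) a1 r.1 + identification_utility E (w k) j r.2).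
  rewrite /P /joint_marginal /joint_utility/= -/(c k).
  by congr (_ * derive1 psi _); rewrite addrAC.
(* If [c k] vanished, so would every probability of a pair with first component [a1], against
   [wpos]. *)
have c0 k : 0 < c k.
  have [[al0 _] _ _] := hq (w k) (w0 k).
  rewrite lt0r mulr_ge0 ?invr_ge0// andbT; apply/eqP => ck.
  have := wpos k; rewrite /first_action_prob big1 ?ltxx// => r _.
  by rewrite big1 ?mulr0// => j _; rewrite PE ck mul0r.
have tot k : 0 < \sum_a2 P (w k) s (a1, a2).
  rewrite (bigD1 s.2)//=; apply: ltr_pwDl; first by rewrite PE mulr_gt0.
  by apply: sumr_ge0 => j _; rewrite PE ltW// mulr_gt0.
have rightE k : right k = m%:R * (c k * derive1 psi (t (w k) a1 s.1 + w k))
    / \sum_a2 P (w k) s (a1, a2).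
  rewrite /right /cond_prob; congr (_ / _).
  rewrite -(sum_correct_actions hE
    (fun x => c k * derive1 psi (t (w k) a1 s.1 + x)) s.2 (w0 k)).
  by apply: eq_bigr => j _; rewrite PE.
have wrongE k : wrong k = (n%:R - m%:R) * (c k * derive1 psi (t (w k) a1 s.1))
    / \sum_a2 P (w k) s (a1, a2).
  rewrite /wrong /cond_prob; congr (_ / _).
  rewrite -[X in derive1 psi X]addr0 -(sum_wrong_actions hE
    (fun x => c k * derive1 psi (t (w k) a1 s.1 + x)) s.2 (w0 k)).
  by apply: eq_bigr => j _; rewrite PE.
have mR : 0 < m%:R :> R by rewrite ltr0n.
have nmR : 0 < n%:R - m%:R :> R by rewrite subr_gt0 ltr_nat.
split=> [k|].
  split; first exact: tot.
    by rewrite rightE; apply: divr_gt0 => //; do 2!apply: mulr_gt0 => //.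
  by rewrite wrongE; apply: divr_gt0 => //; do 2!apply: mulr_gt0 => //.
(* The multiplier for [w k] minimizes the original Lagrangian at [al0] up to [w k], and
   well-posedness of that minimization turns this into convergence. *)
have lac : (q (w k)).2 s.1 @[k --> \oo] --> lambda s.1.
  have [al0 sal0 [max0 min0]] := hlambda.
  apply/cvgrPdist_lt => e e0.
  have [d d0 hd] := lagrangian_min_well_posed p0 dpsi dc dinc dlt1 dgt1 sal0
    min0 (ppos s.1) e0.
  near=> k; rewrite distrC; apply: hd.
  have [sal st mx] := hq (w k) (w0 k).
  apply: le_lt_trans (mixed_saddle_point_near g01 (w0 k) hp ninc sal0 max0
    sal mx _) _.
    exact: (stationary_min p0 (derivable_mixed dpsi)
      (derive1_mixed_increasing _ g01 dpsi dinc) sal st).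
  rewrite ltrD2l; have := w0 k.
  near: k; move/cvgrPdist_lt: wc => /(_ d d0); apply: filterS => k.
  by rewrite sub0r normrN => + k0; rewrite gtr0_norm.
have tc : t (w k) a1 s.1 @[k --> \oo] --> u1 a1 s.1 - lambda s.1.
  by apply: cvgB; [exact: cvg_cst|exact: lac].
rewrite (_ : (fun _ => _) = (fun k => ln (derive1 psi (t (w k) a1 s.1 + w k))
  - ln (derive1 psi (t (w k) a1 s.1))
  - w k * curvature psi (u1 a1 s.1 - lambda s.1))).
  exact: ln_derive1_expansion.
apply/funext => k; rewrite opprD addrA; congr (_ - _).
set x := derive1 psi _; set y := derive1 psi (t _ _ _).
have x0 : 0 < x by exact: dpos.
have y0 : 0 < y by exact: dpos.
(* The weight [c k] and the normalization of the conditional probabilities cancel, and [m / (n - m)]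
   equals [gamma / (1 - gamma)]. *)
have -> : right k / wrong k = gamma / (1 - gamma) * (x / y).
  rewrite rightE wrongE -/x -/y /gamma; field.
  have := tot k; have := c0 k => ck tk.
  by rewrite !gt_eqF// ?ltr0n// ?subr_gt0// ltr_nat.
have [g0 g1] := andP g01.
have lnG (G : R) : 0 < G -> ln (G * (x / y)) = ln G + (ln x - ln y).
  move=> G0; have xy0 : 0 < x / y by exact: divr_gt0.
  by rewrite lnM ?posrE// ln_div ?posrE.
rewrite lnG; last by apply: divr_gt0; rewrite // subr_gt0.
by rewrite addrAC subrr add0r.
Unshelve. all: by end_near. Qed.
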